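(* Let $M$ be a partition matroid on ground set $N=N_1\cup\dots\cup N_\rho$ (disjoint parts) with positive integer capacities $\ell_1,\dots,\ell_\rho$, a set $I$ being independent iff $|I\cap N_i|\le\ell_i$ for all $i$. For $e\in N$ let $N(e)$ be its part and $\ell(e)$ that part's capacity. Consider the algorithm: draw $m$ from $B(|N|,1/2)$, request a uniformly random sample $S$ of $m$ elements, set $I=\varnothing$; for each arriving non-sample element $e$, let $t_e$ be the element of $S\cap N(e)$ with the $\ell(e)$-th largest weight (when it exists), and add $e$ to $I$ if $|I\cap N(e)|<\ell(e)$ and ($|S\cap N(e)|<\ell(e)$ or $w(e)>w(t_e)$); output $I$. This algorithm is a $1/4$-OPT-competitive order-oblivious algorithm for the Matroid Secretary Problem on partition matroids.
   Context: Order-oblivious secretary model: the algorithm receives a uniformly random sample of a chosen size (sampled elements cannot be selected); the other elements arrive in an adversarial order that may depend on the sample but not on the algorithm's random bits, and each must be irrevocably accepted or rejected on arrival; the output must be independent. Weights are nonnegative, ties broken consistently, so the maximum-weight independent set $\mathrm{OPT}$ is unique and contains no weight-$0$ element. An order-oblivious algorithm $\mathcal{A}$ is $c$-OPT-competitive if for every weight function and every $e\in\mathrm{OPT}$, $\mathbb{E}_S[\min_\sigma\Pr_r[e\in\mathcal{A}(S,r,\sigma)]]\ge c$, where $\mathcal{A}(S,r,\sigma)$ is the output given sample $S$, random bits $r$ and arrival order $\sigma$ (which may depend on $S$ and $e$). *)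

(* Defs.v *)
(* MathComp, with the real numbers and the binomial distribution of
   MathComp-Analysis. *)
From HB Require Import structures.
From mathcomp Require Import all_boot all_order all_algebra.
From mathcomp Require Import reals binomial_distribution.

Set Implicit Arguments.
Unset Strict Implicit.
Unset Printing Implicit Defensive.

Import Order.TTheory GRing.Theory Num.Theory.

Local Open Scope ring_scope.

(* Ties are broken by a rank [rk], injective in the statement: [rk e] acts as
   an infinitesimal added to [w e], so that tie-broken weights (of elements and
   of sets) are pairs compared lexicographically. *)
Definition key (R : realType) (N : finType) (rk : N -> nat) (w : N -> R)
    (e : N) : R *l nat :=
  (w e, rk e).

Definition key_sum (R : realType) (N : finType) (rk : N -> nat) (w : N -> R)
    (I : {set N}) : R *l nat :=
  (\sum_(e in I) w e, (\sum_(e in I) rk e)%N).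

(* The maximum-weight independent set; the default [set0] of [arg max] is an
   admissible candidate as soon as it is independent. *)
Definition OPT (R : realType) (N : finType) (indep : pred {set N})
    (rk : N -> nat) (w : N -> R) : {set N} :=
  [arg max_(I > set0 | indep I && [forall e in I, w e != 0])
     key_sum rk w I]%O.

(* The random bits split into those that draw the sample size, accounted for by
   [size_law], and the independent bits [r : bits] of the selection phase.
   [accept w r S past I e] is the decision on the arrival of [e], where [S] is
   the sample, [past] lists the earlier arrivals (in order of arrival) and [I]
   is the set accepted so far; see [nonanticipating] for the role of [w]. *)
Record algorithm (R : realType) (N : finType) := Algorithm {
  size_law : nat -> R;
  bits : finType;
  bits_law : bits -> R;
  accept : (N -> R) -> bits -> {set N} -> seq N -> {set N} -> N -> bool
}.

(* When a decision is made, only the weights of the sampled elements and of the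
   elements that have arrived are known. *)
Definition nonanticipating (R : realType) (N : finType)
    (A : algorithm R N) : Prop :=
  forall (w w' : N -> R) (r : bits A) (S : {set N}) (past : seq N)
      (I : {set N}) (e : N),
    {in [predU S & e :: past], w =1 w'} ->
    accept w r S past I e = accept w' r S past I e.

Fixpoint run (R : realType) (N : finType) (A : algorithm R N) (w : N -> R)
    (r : bits A) (S : {set N}) (past : seq N) (I : {set N})
    (sigma : seq N) : {set N} :=
  if sigma is e :: sigma' then
    run w r S (rcons past e) (if accept w r S past I e then e |: I else I)
      sigma'
  else I.

Definition output (R : realType) (N : finType) (A : algorithm R N)
    (w : N -> R) (r : bits A) (S : {set N}) (sigma : seq N) : {set N} :=
  run w r S [::] set0 sigma.

Definition arrival_orders (N : finType) (S : {set N}) : seq (seq N) :=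
  permutations (enum (~: S)).

Definition order_oblivious_algorithm (R : realType) (N : finType)
    (indep : pred {set N}) (A : algorithm R N) : Prop :=
  [/\ (forall m, 0 <= size_law A m) /\ \sum_(m < #|N|.+1) size_law A m = 1,
      (forall r, 0 <= @bits_law _ _ A r) /\ \sum_r @bits_law _ _ A r = 1,
      nonanticipating A &
      forall (w : N -> R) (r : bits A) (S : {set N}) (sigma : seq N),
        (forall e, 0 <= w e) -> sigma \in arrival_orders S ->
        indep (output w r S sigma) /\ [disjoint output w r S sigma & S]].

(* Draw the size according to [size_law], then a uniformly random subset of
   that size. *)
Definition sample_prob (R : realType) (N : finType) (A : algorithm R N)
    (S : {set N}) : R :=
  size_law A #|S| / 'C(#|N|, #|S|)%:R.

Definition select_prob (R : realType) (N : finType) (A : algorithm R N)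
    (w : N -> R) (S : {set N}) (sigma : seq N) (e : N) : R :=
  \sum_(r | e \in output w r S sigma) @bits_law _ _ A r.

(* The neutral value 1 does not affect the minimum: there is at least one
   arrival order, and probabilities are at most 1. *)
Definition OPT_competitive (R : realType) (N : finType)
    (indep : pred {set N}) (rk : N -> nat) (A : algorithm R N) (c : R) : Prop :=
  forall w : N -> R, (forall e, 0 <= w e) ->
  forall e, e \in OPT indep rk w ->
    c <= \sum_(S : {set N}) sample_prob A S *
           \big[Order.min/1]_(sigma <- arrival_orders S)
             select_prob A w S sigma e.

(* The ground set is partitioned into the fibres of [part]. *)
Definition part_of (N : finType) (rho : nat) (part : N -> 'I_rho)
    (i : 'I_rho) : {set N} :=
  [set e | part e == i].

Definition partition_indep (N : finType) (rho : nat) (part : N -> 'I_rho)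
    (ell : 'I_rho -> nat) : pred {set N} :=
  fun I => [forall i, #|I :&: part_of part i| <= ell i]%N.

(* The element of [T] of [k]-th largest weight (counting from 1), meaningful
   for [0 < k <= #|T|]; [x0] is the value outside of that range. *)
Definition kth_largest (R : realType) (N : finType) (rk : N -> nat)
    (w : N -> R) (x0 : N) (T : {set N}) (k : nat) : N :=
  nth x0 (sort (fun e f => (key rk w f <= key rk w e)%O) (enum T)) k.-1.

Definition partition_accept (R : realType) (N : finType) (rho : nat)
    (part : N -> 'I_rho) (ell : 'I_rho -> nat) (rk : N -> nat)
    (w : N -> R) (S I : {set N}) (e : N) : bool :=
  let Ne := part_of part (part e) in
  let le := ell (part e) in
  let t := kth_largest rk w e (S :&: Ne) le in
  (#|I :&: Ne| < le)%N &&
  ((#|S :&: Ne| < le)%N || (key rk w t < key rk w e)%O).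

(* The selection phase is deterministic. *)
Definition partition_algorithm (R : realType) (N : finType) (rho : nat)
    (part : N -> 'I_rho) (ell : 'I_rho -> nat) (rk : N -> nat) :
    algorithm R N :=
  {| size_law := binomial_pmf #|N| 2^-1;
     bits := unit;
     bits_law := fun=> 1;
     accept := fun w _ S _ I e => partition_accept part ell rk w S I e |}.

(* Main.v *)
(* Call an element of the part of [e] qualified when fewer than [ell] sampled
   elements of the part exceed it; up to capacity, the algorithm accepts exactly
   the qualified non-sampled elements. An element [e] of OPT is among the [ell]
   largest of its part, hence qualified, and it is accepted in every arrival
   order if it is not sampled and fewer than [ell] other non-sampled elements of
   its part are qualified. Since [S] is a uniformly random subset of the ground
   set, exchanging the roles of "sampled" and "non-sampled" on the part of [e]
   minus [e] preserves its law; this exchange maps the samples for which the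
   second condition fails to samples for which it holds. So that condition has
   conditional probability at least 1/2 given the event [e \notin S], of
   probability 1/2. *)
Require Import Defs.
From HB Require Import structures.
From mathcomp Require Import all_boot all_order all_algebra.
From mathcomp Require Import reals binomial_distribution.

Set Implicit Arguments.
Unset Strict Implicit.
Unset Printing Implicit Defensive.

Import Order.TTheory GRing.Theory Num.Theory.

Local Open Scope ring_scope.

(** * Counting in sorted lists and in families of subsets *)

(** The elements satisfying [p] form a prefix of [s], of length [count p s]. *)
Lemma sorted_nth_count (T : Type) (leT : rel T) (p : pred T) (x0 : T)
    (s : seq T) (i : nat) :
  transitive leT -> (forall x y, leT x y -> p y -> p x) ->
  sorted leT s -> (i < size s)%N -> p (nth x0 s i) = (i < count p s)%N.
Proof.
move=> leT_tr p_up; elim: s i => [//|x s IHs] i /= s_sorted.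
case px: (p x).
  by case: i => [|i] //= lt_i; rewrite IHs ?(path_sorted s_sorted).
have s_notp: all (predC p) s.
  have /= := order_path_min leT_tr s_sorted.
  by apply: sub_all => y /p_up py /=; apply/negP => /py; rewrite px.
have ->: count p s = 0%N.
  by apply/eqP; rewrite -leqn0 leqNgt -has_count -all_predC.
case: i => [|i] //= lt_i.
by apply/negbTE; have /all_nthP := s_notp; apply.
Qed.

(** Symmetric difference with [D] is an involution that keeps [e] outside, so among the
    [2 ^ #|N|.-1] sets avoiding [e] those violating [P] are no more numerous than those satisfying
    it. *)
Lemma half_le_card_of_flip (N : finType) (e : N) (P : pred {set N})
    (D : {set N}) :
  e \notin D ->
  (forall S : {set N}, e \notin S -> ~~ P S ->
     P ((S :\: D) :|: (D :\: S))) ->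
  (2 ^ #|N|.-1 <= #|[set S : {set N} | (e \notin S) && P S]|.*2)%N.
Proof.
move=> eD Pflip; pose flip (S : {set N}) := (S :\: D) :|: (D :\: S).
have flipK: involutive flip.
  move=> S; apply/setP => x; rewrite !inE.
  by case: (x \in S) (x \in D) => [] [].
set G := [set S | _]; pose B := [set S : {set N} | (e \notin S) && ~~ P S].
have le_BG: (#|B| <= #|G|)%N.
  rewrite -(card_imset _ (inv_inj flipK)); apply: subset_leq_card.
  apply/subsetP => _ /imsetP[S /[!inE] /andP[eS nPS] ->].
  by rewrite (Pflip _ eS nPS) andbT /flip !inE (negbTE eS) (negbTE eD).
have <-: (#|G| + #|B|)%N = (2 ^ #|N|.-1)%N.
  rewrite -(cardsC1 e) -card_powerset -cardsUI.
  rewrite (_ : G :&: B = set0) ?cards0 ?addn0; last first.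
    by apply/setP => S; rewrite !inE; case: (P S); rewrite ?andbF.
  apply: eq_card => S; rewrite !inE -andb_orr orbN andbT.
  by rewrite subsetC sub1set inE.
by rewrite -addnn leq_add2l.
Qed.

(** * Comparison of elements by tie-broken weight *)

Section Keys.
Context {R : realType} {N : finType} (rk : N -> nat) (w : N -> R).

(** Candidates come from [A] and are ranked against [B]; with both as arguments, exchanging sampled
    and non-sampled elements amounts to swapping [A] and [B]. *)
Definition qualified (k : nat) (A B : {set N}) : {set N} :=
  [set f in A | (#|[set g in B | (key rk w f <= key rk w g)%O]| < k)%N].

Lemma in_qualified (k : nat) (A B : {set N}) (f : N) :
  (f \in qualified k A B) =
  (f \in A) && (#|[set g in B | (key rk w f <= key rk w g)%O]| < k)%N.
Proof. by rewrite inE. Qed.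

Lemma ex_min_key (Q : {set N}) : (0 < #|Q|)%N ->
  exists2 a, a \in Q & {in Q, forall g, (key rk w a <= key rk w g)%O}.
Proof.
rewrite card_gt0 => /set0Pn[a aQ].
by case: (arg_minP (key rk w) aQ) => b; exists b.
Qed.

(* The least key among the [k] or more qualified elements of both sides
   belongs, say, to some [a] in [A]; the qualified elements of [B] then all have
   keys at least that of [a], so that [a] is not qualified. *)
Lemma qualified_lt (k : nat) (A B : {set N}) : (0 < k)%N ->
  (k <= #|qualified k A B|)%N -> (#|qualified k B A| < k)%N.
Proof.
move=> k_gt0 leA; rewrite ltnNge; apply/negP => leB.
have [a aA a_min] := ex_min_key (leq_trans k_gt0 leA).
have [b bB b_min] := ex_min_key (leq_trans k_gt0 leB).
wlog le_ab: A B leA leB a aA a_min b bB b_min / (key rk w a <= key rk w b)%O.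
  move=> wl; case/orP: (le_total (key rk w a) (key rk w b)).
    exact: (wl A B leA leB a aA a_min b bB b_min).
  exact: (wl B A leB leA b bB b_min a aA a_min).
move: aA; rewrite in_qualified => /andP[_]; rewrite ltnNge => /negP; apply.
apply: leq_trans leB _; apply: subset_leq_card; apply/subsetP => g gB.
rewrite inE (le_trans le_ab (b_min g gB)) andbT.
by move: gB; rewrite in_qualified => /andP[].
Qed.

Lemma kth_largest_lt (x0 : N) (T : {set N}) (k : nat) (f : N) :
  (0 < k <= #|T|)%N ->
  (key rk w (kth_largest rk w x0 T k) < key rk w f)%O =
  (#|[set g in T | (key rk w f <= key rk w g)%O]| < k)%N.
Proof.
case: k => // k /= ltk; rewrite /kth_largest /=.
set leT := fun e f : N => _; set s := sort _ _.
have leT_tr: transitive leT by move=> y x z xy yz; exact: le_trans yz xy.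
have s_sorted: sorted leT s by apply: sort_sorted => x y; exact: le_total.
(* Keys at least that of [f] come first in the decreasing list, so the entry of index [k] lies
   beyond them iff there are at most [k] of them. *)
rewrite ltNge (sorted_nth_count (leT := leT)
  (p := fun g => key rk w f <= key rk w g)%O) //.
- rewrite -leqNgt ltnS (permP (permEl (perm_sort leT _))) -size_filter.
  congr (_ <= k)%N; rewrite cardE /enum_mem -filter_predI.
  by congr size; apply: eq_filter => g; rewrite /= inE andbC.
- by move=> x y xy fy; exact: le_trans fy xy.
- by rewrite size_sort -cardE.
Qed.

End Keys.

(** * Invariants and splitting of a run *)

Section Runs.
Context {R : realType} {N : finType} (A : algorithm R N) (w : N -> R)
  (r : bits A) (S : {set N}).

Lemma run_ind (P : {set N} -> Prop) (past sigma : seq N) (I : {set N}) :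
  (forall past' J f, f \in sigma -> P J -> accept w r S past' J f ->
     P (f |: J)) ->
  P I -> P (run w r S past I sigma).
Proof.
elim: sigma past I => [//|e sigma IHs] past I Pstep PI /=.
apply: IHs => [past1 J f f_s|]; first by apply: Pstep; rewrite inE f_s orbT.
by case: ifP => // acc; apply: Pstep acc; rewrite ?mem_head.
Qed.

Lemma run_cat (past s1 s2 : seq N) (I : {set N}) :
  run w r S past I (s1 ++ s2) =
  run w r S (past ++ s1) (run w r S past I s1) s2.
Proof.
elim: s1 past I => [|e s1 IHs] past I /=; first by rewrite cats0.
by rewrite IHs cat_rcons.
Qed.

End Runs.

(** * The algorithm on a partition matroid *)

Section Partition.
Context {R : realType} {N : finType} {rho : nat}
  (part : N -> 'I_rho) (ell : 'I_rho -> nat) (rk : N -> nat).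
Hypothesis ell_gt0 : forall i, (0 < ell i)%N.

Local Notation "''P_' e" := (part_of part (part e))
  (at level 8, e at level 2).

(** Both cases of the threshold test become a single count, which reads only the weights of [e] and
    of sampled elements. *)
Lemma partition_acceptE (w : N -> R) (S I : {set N}) (e : N) :
  partition_accept part ell rk w S I e =
  (#|I :&: 'P_e| < ell (part e))%N &&
  (#|[set g in S :&: 'P_e | (key rk w e <= key rk w g)%O]| < ell (part e))%N.
Proof.
rewrite /partition_accept; congr (_ && _).
have [ltSl|leSl] := ltnP; last by rewrite kth_largest_lt // ell_gt0.
apply/esym/(leq_ltn_trans _ ltSl)/subset_leq_card.
by apply/subsetP => g /[!inE] /andP[].
Qed.

(** Exchange argument: if [ell (part e)] elements of the part exceeded [e], one of them would lie
    outside OPT, and trading [e] for it would give a heavier admissible set. *)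
Lemma OPT_card_gt (w : N -> R) (e : N) : (forall f, 0 <= w f) ->
  e \in OPT (partition_indep part ell) rk w ->
  (#|[set f in 'P_e | (key rk w e < key rk w f)%O]| < ell (part e))%N.
Proof.
move=> w_ge0; rewrite /OPT.
case: arg_maxP => [|O /andP[O_indep O_neq0] O_max eO].
  by apply/andP; split; apply/forallP => i; rewrite ?set0I ?cards0 ?inE.
rewrite ltnNge; apply/negP; set U := [set f in _ | _] => leU.
have OP_le: (#|O :&: 'P_e| <= ell (part e))%N by move/forallP: O_indep.
(* Together with [e], the set [U] exceeds the capacity of the part. *)
have /subsetPn[f fU fO]: ~~ (U \subset O).
  apply/negP => sUO; have: (#|e |: U| <= #|O :&: 'P_e|)%N.
    apply/subset_leq_card/subsetP => g /[!inE] /orP[/eqP->|gU].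
      by rewrite eO eqxx.
    by have /andP[-> _] := gU; rewrite (subsetP sUO) // !inE.
  by rewrite cardsU1 !inE ltxx andbF /= add1n leqNgt ltnS (leq_trans OP_le).
move: fU; rewrite !inE => /andP[/eqP part_f].
rewrite ltxi_pair /= => /andP[le_w lt_rk].
have /O_max: partition_indep part ell (f |: O :\ e) &&
    [forall g in f |: O :\ e, w g != 0].
  apply/andP; split; [apply/forallP => i | apply/forall_inP => g]; last first.
    rewrite !inE => /orP[/eqP->|/andP[_ gO]].
      (* The newcomer [f] has positive weight: [w e <= w f], and [w e] is nonzero because [e] is in
         [O]. *)
      rewrite gt_eqF // (lt_le_trans _ le_w) // lt0r w_ge0 andbT.
      by move/forall_inP: O_neq0; apply.
    by move/forall_inP: O_neq0; apply.
  have [->|ne_i] := eqVneq i (part e); last first.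
    rewrite (leq_trans _ (forallP O_indep i)) //; apply/subset_leq_card.
    apply/subsetP => g /[!inE] /andP[/orP[/eqP->|/andP[_ ->] //]].
    by rewrite part_f eq_sym (negbTE ne_i).
  apply: leq_trans OP_le; rewrite [leqRHS](cardsD1 e) !inE eO eqxx /=.
  rewrite (_ : _ :&: _ = f |: (O :&: 'P_e) :\ e) ?cardsU1 ?leq_add2r ?leq_b1 //.
  apply/setP => g; rewrite !inE; case: (eqVneq g f) => [->|_] /=.
    by rewrite part_f eqxx.
  by rewrite andbA.
rewrite /= leNgt => /negP; apply; rewrite /key_sum.
have fOe: f \notin O :\ e by rewrite !inE negb_and fO orbT.
rewrite !(big_setU1 _ fOe) /= !(big_setD1 e eO) /= ltxi_pair lerD2r le_w /=.
by rewrite lerD2r ltEnat /= ltn_add2r.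
Qed.

Lemma mem_arrival_orders (S : {set N}) (sigma : seq N) :
  sigma \in arrival_orders S -> sigma =i ~: S.
Proof.
by rewrite mem_permutations => /perm_mem mem_s x; rewrite mem_s mem_enum.
Qed.

Lemma output_partition (w : N -> R) (r : unit) (S : {set N}) (sigma : seq N) :
  sigma \in arrival_orders S ->
  let I := output (A := partition_algorithm R part ell rk) w r S sigma in
  partition_indep part ell I /\ [disjoint I & S].
Proof.
move=> /mem_arrival_orders mem_s; rewrite /output.
apply: (run_ind (P := fun I =>
  partition_indep part ell I /\ [disjoint I & S])); last first.
  split; last by rewrite disjoints_subset sub0set.
  by apply/forallP => i; rewrite set0I cards0.
move=> past J f f_s [J_indep JS] /=.
rewrite partition_acceptE => /andP[ltJ _]; split; last first.
  by rewrite disjoints_subset subUset sub1set -mem_s f_s -disjoints_subset.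
apply/forallP => i; have [->|ne_i] := eqVneq i (part f).
  by apply: leq_trans ltJ; rewrite setIUl (leq_trans (leq_card_setU _ _)) //
    -add1n leq_add2r (leq_trans (subset_leq_card (subsetIl _ _))) ?cards1.
rewrite (leq_trans _ (forallP J_indep i)) //; apply/subset_leq_card.
apply/subsetP => g /[!inE] /andP[/orP[/eqP->|-> //]].
by rewrite eq_sym (negbTE ne_i).
Qed.

Hypothesis rk_inj : injective rk.

(** Elements of the part accepted before [e] are non-sampled and qualified, hence too few to fill
    it; being among the largest of its part, [e] passes the threshold test. *)
Lemma output_mem (w : N -> R) (r : unit) (S : {set N}) (sigma : seq N) (e : N) :
  sigma \in arrival_orders S -> e \notin S ->
  (#|[set f in 'P_e | (key rk w e < key rk w f)%O]| < ell (part e))%N ->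
  (#|qualified rk w (ell (part e)) ('P_e :\ e :\: S) (S :&: 'P_e)|
     < ell (part e))%N ->
  e \in output (A := partition_algorithm R part ell rk) w r S sigma.
Proof.
move=> /mem_arrival_orders mem_s eS e_top ltQ.
set Q := qualified _ _ _ _ _ in ltQ.
have e_sigma : e \in sigma by rewrite mem_s inE.
case/splitPr: e_sigma mem_s => s1 s2 mem_s.
rewrite /output run_cat /=; set J := run _ _ _ _ _ s1.
(* Acceptance is never revoked, so arrivals after [e] are harmless. *)
apply: (run_ind (P := fun I => e \in I)) => [? I f _ eI _|].
  by rewrite inE eI orbT.
have sJQ : (J :&: 'P_e) :\ e \subset Q.
  apply: (run_ind (P := fun I => (I :&: 'P_e) :\ e \subset Q)); last first.
    by rewrite set0I set0D sub0set.
  move=> past I f f_s1 sIQ /=; rewrite partition_acceptE => /andP[_ f_qual].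
  apply/subsetP => g; rewrite in_setD1 in_setI in_setU1.
  move=> /and3P[ge /orP[/eqP gf|gI] gP]; last first.
    by rewrite (subsetP sIQ) // in_setD1 ge in_setI gI.
  move: gP f_qual; rewrite inE -gf => /eqP part_g.
  rewrite part_g /Q in_qualified => ->; rewrite !inE ge part_g eqxx !andbT.
  have: f \in s1 ++ e :: s2 by rewrite mem_cat f_s1.
  by rewrite mem_s inE gf.
case: ifPn => [_|]; first by rewrite setU11.
apply: contraNT => eJ; rewrite partition_acceptE; apply/andP; split.
  apply: leq_ltn_trans ltQ; rewrite (leq_trans _ (subset_leq_card sJQ)) //.
  apply/subset_leq_card/subsetP => g /[!inE] /andP[gJ ->].
  by rewrite gJ !andbT; apply: contraNneq eJ => <-.
(* Sampled keys at least that of [e] are strictly larger, since [e] is not sampled and ranks are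
   distinct. *)
apply: leq_ltn_trans e_top; apply/subset_leq_card/subsetP => g /[!inE].
move=> /andP[/andP[gS ->]]; rewrite lt_neqAle => ->; rewrite andbT /=.
by apply: contraNneq eS => -[_ /rk_inj ->].
Qed.

End Partition.

(** * Law of the sample and the competitive ratio *)

(** The binomial coefficient cancels, so the sample is uniform among all subsets. *)
Lemma sample_prob_binomial (R : realType) (N : finType) (A : algorithm R N)
    (S : {set N}) :
  (forall m, size_law A m = binomial_pmf #|N| 2^-1 m) ->
  sample_prob A S = 2^-1 ^+ #|N|.
Proof.
move=> lawE; rewrite /sample_prob lawE /binomial_pmf /unstable.onem.
have le_S: (#|S| <= #|N|)%N by exact: max_card.
rewrite (_ : 1 - 2^-1 = 2^-1 :> R); last first.
  by rewrite {1}[1]splitr mul1r addrK.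
rewrite -exprD subnKC // -mulr_natr mulfK // pnatr_eq0 -lt0n bin_gt0.
exact: le_S.
Qed.

Lemma sum_binomial_pmf (R : realType) (n : nat) (p : R) :
  \sum_(m < n.+1) binomial_pmf n p m = 1.
Proof.
rewrite -[RHS](expr1n _ n) -[in RHS](subrK p 1) exprDn.
by apply: eq_bigr => m _; rewrite /binomial_pmf mulrC.
Qed.

Theorem theorem22 (R : realType) (N : finType) (rho : nat)
    (part : N -> 'I_rho) (ell : 'I_rho -> nat) (rk : N -> nat)
    (ell_gt0 : forall i, (0 < ell i)%N) (rk_inj : injective rk) :
  order_oblivious_algorithm (partition_indep part ell)
    (partition_algorithm R part ell rk) /\
  OPT_competitive (partition_indep part ell) rk
    (partition_algorithm R part ell rk) 4^-1.
Proof.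
split.
  split; last by move=> w r S sigma _; exact: output_partition.
  - split=> [m|] /=; last exact: sum_binomial_pmf.
    by apply: binomial_pmf_ge0; rewrite invr_ge0 ler0n invf_le1 ?ler1n.
  - by split=> [r|]; rewrite ?ler01 // big_const card_unit /= addr0.
  move=> w w' r S past I e eq_w /=; rewrite !partition_acceptE //.
  congr (_ && (_ < _)%N); apply: eq_card => g; rewrite !inE.
  have [gS|] //= := boolP (g \in S).
  by rewrite /key !eq_w // !inE ?gS ?eqxx ?orbT.
move=> w w_ge0 e /(OPT_card_gt w_ge0) e_top.
pose k := ell (part e); pose D := part_of part (part e) :\ e.
pose good (S : {set N}) :=
  (#|qualified rk w k (D :\: S) (S :&: part_of part (part e))| < k)%N.
have eD : e \notin D by rewrite !inE eqxx.
have half : (2 ^ #|N|.-1 <=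
    #|[set S : {set N} | (e \notin S) && good S]|.*2)%N.
  apply: (half_le_card_of_flip (D := D)) => // S eS; rewrite -leqNgt.
  (* As [e \notin S], flipping [S] along [D] swaps the two sets compared by [qualified]. *)
  move=> /(qualified_lt (ell_gt0 _)); congr (#|qualified _ _ _ _ _| < k)%N.
    apply/setP => g; rewrite !inE.
    have [->|] := eqVneq g e; first by rewrite (negbTE eS) !andbF.
    by case: (g \in S); case: (part g == part e).
  apply/setP => g; rewrite !inE.
  have [->|] := eqVneq g e; first by rewrite (negbTE eS) !andbF.
  by case: (g \in S); case: (part g == part e).
apply: (@le_trans _ _ (\sum_(S : {set N} | (e \notin S) && good S)
                         2^-1 ^+ #|N|)).
  (* At least half of [2 ^ #|N|.-1] samples, each of probability [2^-1 ^+ #|N|], have total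
     probability at least 1/4. *)
  rewrite sumr_const -[leRHS]mulr_natl -cardsE exprVn.
  rewrite ler_pdivlMr ?exprn_gt0 // ler_pdivrMl // -natrX -natrM ler_nat.
  have N_gt0: (0 < #|N|)%N by apply/card_gt0P; exists e.
  by rewrite -(prednK N_gt0) expnS -[4%N]/(2 * 2)%N -mulnA leq_pmul2l // mul2n.
rewrite big_mkcond; apply: ler_sum => S _.
rewrite (@sample_prob_binomial R N (partition_algorithm R part ell rk)) //.
have pow_ge0: 0 <= 2^-1 ^+ #|N| :> R by rewrite exprn_ge0 ?invr_ge0.
have sel_ge0 sigma :
    0 <= select_prob (partition_algorithm R part ell rk) w S sigma e.
  by apply: sumr_ge0.
(* On a good sample avoiding [e], every order selects [e] with probability 1; other samples
   contribute at least 0. *)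
case: ifP => [/andP[eS goodS]|_].
  rewrite -[leLHS]mulr1 ler_wpM2l // big_seq.
  apply: (big_ind (fun x => 1 <= x)) => // [x y x1 y1|sigma sigma_ord].
    by rewrite le_min x1.
  rewrite /select_prob (eq_bigl xpredT) => [|r]; last exact: output_mem.
  by rewrite /= big_const card_unit /= addr0.
apply: mulr_ge0 => //; apply: (big_ind (fun x => 0 <= x)) => // x y x0 y0.
by rewrite le_min x0.
Qed.
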